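(* The following conditions are equivalent: (1) $\omega_1<\mathfrak b$. (2) For every K-analytic Hausdorff space $X$: $X$ is analytic if and only if every compact subset of $X$ is metrizable. (3) For every K-analytic space $X$: $X$ is countable if and only if every compact subset of $X$ is countable. (4) For every K-analytic Hausdorff space $X$ with a unique non-isolated point: $X$ is countable if and only if every compact subset of $X$ is countable.
   Context: ''Countable'' means at most countable. $\mathfrak b$ is the smallest cardinality of a subset $B\subset\omega^\omega$ such that for every $y\in\omega^\omega$ there exists $x\in B$ with $x\not\le^* y$, where $x\le^* y$ means that the set $\{n\in\omega:x(n)\not\le y(n)\}$ is finite. A space is Čech-complete if it is Tychonoff and is a $G_\delta$-set in some (equivalently, any) of its compactifications. A topological space is Polish if it is homeomorphic to a separable complete metric space. A topological space is Lindelöf if each of its open covers has a countable subcover. A topological space $X$ is analytic if it is a continuous image of a Polish space, and K-analytic if it is a continuous image of a Lindelöf Čech-complete space (no separation axiom on $X$ is included in these definitions). *)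

(* Defs.v *)
From HB Require Import structures.
From mathcomp Require Import all_boot all_order all_algebra.
From mathcomp Require Import all_classical all_reals.
From mathcomp Require Import topology normedtype borel_hierarchy.

Set Implicit Arguments.
Unset Strict Implicit.
Unset Printing Implicit Defensive.

Local Open Scope classical_set_scope.
Local Open Scope card_scope.

Definition card_lt (T U : Type) (A : set T) (B : set U) : Prop :=
  A #<= B /\ ~ (B #<= A).

(* Cardinals are represented by sets, up to the relational comparison [#<=]:
   [is_omega1 A] means |A| = omega_1, [is_bounding_number B] means |B| = b. *)
Definition is_omega1 (T : Type) (A : set T) : Prop :=
  ~ countable A /\
  forall (U : Type) (B : set U), ~ countable B -> A #<= B.

Definition le_star (x y : nat -> nat) : Prop :=
  finite_set [set n | ~ (x n <= y n)%N].

Definition star_unbounded (B : set (nat -> nat)) : Prop :=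
  forall y : nat -> nat, exists2 x, B x & ~ le_star x y.

Definition is_bounding_number (B : set (nat -> nat)) : Prop :=
  star_unbounded B /\
  forall B' : set (nat -> nat), star_unbounded B' -> B #<= B'.

(* Both cardinals exist and are unique up to equipotence, so the choice of
   representatives is immaterial. *)
Definition omega1_lt_b : Prop :=
  exists (T : Type) (A : set T) (B : set (nat -> nat)),
    [/\ is_omega1 A, is_bounding_number B & card_lt A B].

Definition homeomorphism (X Y : topologicalType) (f : X -> Y) : Prop :=
  continuous f /\
  exists g : Y -> X, [/\ continuous g, cancel f g & cancel g f].

Definition topological_embedding (X Y : topologicalType) (f : X -> Y) : Prop :=
  injective f /\
  forall U : set X, open U <-> exists2 V : set Y, open V & f @^-1` V = U.

Definition continuous_image (Z X : topologicalType) : Prop :=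
  exists2 f : Z -> X, continuous f & range f = [set: X].

Definition lindelof_space (X : topologicalType) : Prop :=
  forall C : set (set X), C `<=` open -> \bigcup_(U in C) U = [set: X] ->
    exists D : set (set X),
      [/\ D `<=` C, countable D & \bigcup_(U in D) U = [set: X]].

Definition tychonoff_space (X : topologicalType) : Prop :=
  hausdorff_space X /\ completely_regular_space X.

Definition compactification (X K : topologicalType) (e : X -> K) : Prop :=
  [/\ compact [set: K], hausdorff_space K, topological_embedding e
    & dense (range e)].

Definition cech_complete (X : topologicalType) : Prop :=
  tychonoff_space X /\
  exists (K : topologicalType) (e : X -> K),
    compactification e /\ Gdelta (range e).

Definition K_analytic (X : topologicalType) : Prop :=
  exists Z : topologicalType,
    [/\ lindelof_space Z, cech_complete Z & continuous_image Z X].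

Definition separable_space (X : topologicalType) : Prop :=
  exists2 D : set X, countable D & dense D.

(* The completeness axiom of [completeType], which is not used itself because
   it is pointed and would exclude the empty space. *)
Definition complete_space (M : uniformType) : Prop :=
  forall F : set_system M, ProperFilter F -> cauchy F -> exists x : M, F --> x.

Definition metrizable (R : realType) (X : topologicalType) : Prop :=
  exists (M : metricType R) (f : X -> M), homeomorphism f.

Definition polish (R : realType) (X : topologicalType) : Prop :=
  exists (M : metricType R) (f : X -> M),
    [/\ separable_space M, complete_space M & homeomorphism f].

Definition analytic (R : realType) (X : topologicalType) : Prop :=
  exists2 Z : topologicalType, polish R Z & continuous_image Z X.

Definition unique_non_isolated_point (X : topologicalType) : Prop :=
  exists! x : X, ~ isolated [set: X] x.

(* Main.v *)
Require Import Defs.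
From HB Require Import structures.
From mathcomp Require Import all_boot all_order all_algebra.
From mathcomp Require Import all_classical all_reals.
From mathcomp Require Import interval_inference topology normedtype borel_hierarchy.
From mathcomp Require wochoice.
From mathcomp Require Import lra.

(** A K-analytic space [X] is the image of a Lindeloef space [Z] that is a
    G-delta set in a compact space [K].  Covering [Z], for each [n], by countably
    many closed sets [F n k] contained in the [n]-th open set of the G-delta
    representation and letting [Phi y] be the image of
    [bigcap_n bigcup_(k <= y n) F n k], one obtains a monotone, upper
    semicontinuous map from the Baire space to the compact subsets of [X] whose
    values cover [X] ([K_analytic_usco_resolution]).

    Suppose that [omega_1 < b].  Among uncountably many elements of the Baire
    space uncountably many lie pointwise below a single [z]
    ([omega1_lt_b_bounded]), so, by monotonicity, any uncountable family of
    points of [X] has uncountably many members in a single compact set [Phi z].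
    Hence [X] is countable when its compact subsets are.  When [X] is Hausdorff
    with metrizable compact subsets, the same principle applied to pairs of
    points shows that countably many pairs of disjoint open sets separate the
    points of [X] ([omega1_lt_b_separating]): a failure would produce [omega_1]
    pairs of points, none in an open box chosen around an earlier one, and
    uncountably many of these pairs would come from one compact metrizable set.
    With such a countable family, each point of [Phi y] is coded by [y] and a
    sequence of bits; the codes form a closed subset of the Baire space and
    decoding is continuous, so [X] is analytic ([coding_analytic]).  Conversely,
    an analytic space has a countable network, and a compact Hausdorff space with
    a countable network is metrizable ([compact_network_metrizable]).  The
    latter also makes countable compact sets metrizable, and a countable network
    leaves room for countably many isolated points only; thus the
    characterization of analytic spaces yields the countability of the spaces
    with one non-isolated point.

    Suppose that [omega_1 < b] fails.  Then there is a family [x] of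
    [omega_1] elements of the Baire space all of whose uncountable subfamilies
    are unbounded ([not_omega1_lt_b_unbounded]).  On its index set with a point
    at infinity there is a topology for which each set of indices
    [{i | x i <= y}] together with infinity is compact, upper semicontinuously
    in [y]; this makes the space K-analytic, while a compact set contains only a
    pointwise bounded, hence countable, part of the index set.  So the
    uncountable space [fan x] with one non-isolated point refutes the last
    condition. *)

Set Implicit Arguments.
Unset Strict Implicit.
Unset Printing Implicit Defensive.

Local Open Scope classical_set_scope.
Local Open Scope card_scope.

(** * Countable sets, eventual domination and the order type omega_1 *)

Lemma card_le_injP (T U : Type) (A : set T) (B : set U) :
  A #<= B <-> exists f : A -> B, injective f.
Proof.
split=> [/card_leP[f]|[f finj]].
  have finj : set_inj [set: A] f by exact: inj.
  by exists f => a b fab; apply: finj; rewrite ?inE.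
apply/card_leP/injfunPex; exists f => // a b _ _; exact: finj.
Qed.

Lemma countableS (T : Type) (A B : set T) :
  A `<=` B -> countable B -> countable A.
Proof. by move=> AB; apply: sub_countable; apply: subset_card_le. Qed.

Lemma countable_image (T U : Type) (f : T -> U) (A : set T) :
  countable A -> countable (f @` A).
Proof. by apply: sub_countable; apply: card_image_le. Qed.

Lemma countable_inj_on (T U : Type) (f : T -> U) (A : set T) (B : set U) :
  (forall x, A x -> B (f x)) -> (forall x y, A x -> A y -> f x = f y -> x = y) ->
  countable B -> countable A.
Proof.
move=> fAB finj cB.
have /countable_injP[g ginj] := cB.
apply/countable_injP; exists (g \o f) => x y /set_mem Ax /set_mem Ay /= e.
by apply: finj => //; apply: ginj e; apply/mem_set/fAB.
Qed.

(** Countably many choices arranged in a sequence; the condition [Q] also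
    constrains the arbitrary values taken off the codes of [A], which cannot be
    avoided when [A] is finite or empty. *)
Lemma countable_choice (T V : Type) (A : set T) (Q : V -> Prop)
    (P : T -> V -> Prop) :
  countable A -> (exists v, Q v) ->
  (forall a, A a -> exists2 v, Q v & P a v) ->
  exists u : nat -> V, (forall n, Q (u n)) /\ forall a, A a -> exists n, P a (u n).
Proof.
move=> /countable_injP[g ginj] [v0 Qv0] AP.
have /choice[u uP] : forall n, exists v, Q v /\ forall a, A a -> g a = n -> P a v.
  move=> n; have [[a [Aa gan]]|noa] := pselect (exists a, A a /\ g a = n).
    have [v Qv Pav] := AP a Aa; exists v; split=> // b Ab gbn.
    by rewrite (_ : b = a)//; apply: ginj; rewrite ?inE// gbn.
  by exists v0; split=> // a Aa gan; exfalso; apply: noa; exists a.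
exists u; split=> [n|a Aa]; first by have [] := uP n.
by exists (g a); have [_] := uP (g a); apply.
Qed.

Lemma le_starP (x y : nat -> nat) :
  le_star x y <-> exists m, forall n, (m <= n)%N -> (x n <= y n)%N.
Proof.
split=> [/finite_seqP[X XE]|[m mP]].
  exists (\max_(i <- X) i).+1 => n nX; apply: contrapT => nxy.
  have : n \in X by have : [set` X] n by rewrite -XE.
  by move=> /(@leq_bigmax_seq _ _ xpredT id) => /(_ isT); rewrite leqNgt nX.
apply: (@sub_finite_set _ _ `I_m) => [n /= nxy|]; last exact: finite_II.
by rewrite ltnNge; apply/negP => /mP.
Qed.

Lemma le_star_shift (x y : nat -> nat) :
  le_star x y -> exists m, forall n, (x n <= y n + m)%N.
Proof.
move=> /le_starP[m mP]; exists (\max_(i < m) x i) => n.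
have [/mP|nm] := leqP m n; first by move=> ?; apply: leq_trans (leq_addr _ _).
by apply: leq_trans (leq_addl _ _); apply: (leq_bigmax (Ordinal nm)).
Qed.

(** Diagonalization: the [n]-th value dominates the first [n] functions. *)
Lemma countable_le_star_bounded (I : Type) (S : set I) (x : I -> nat -> nat) :
  countable S -> exists y, forall i, S i -> le_star (x i) y.
Proof.
move=> cS.
have [||z [_ zP]] := @countable_choice I (nat -> nat) S (fun _ => True)
  (fun i z => z = x i) cS; first by exists (fun=> 0).
  by move=> i _; exists (x i).
exists (fun n => \max_(k < n.+1) z k n) => i /zP[k zk].
apply/le_starP; exists k => n kn; rewrite -zk.
exact: (leq_bigmax (Ordinal (kn : k < n.+1)%N)).
Qed.

Lemma star_unbounded_uncountable (B : set (nat -> nat)) :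
  star_unbounded B -> ~ countable B.
Proof.
move=> ub cB; have [y yP] := @countable_le_star_bounded _ B id cB.
by have [x Bx []] := ub y; apply: yP.
Qed.

Lemma star_unboundedT : star_unbounded [set: nat -> nat].
Proof.
move=> y; exists (fun n => (y n).+1) => // /le_starP[m /(_ m (leqnn m))].
by rewrite ltnn.
Qed.

(** Well-foundedness and trichotomy make [lt] a well-order; the other two
    fields say that its order type is omega_1. *)
Record omega1_like (I : Type) (lt : I -> I -> Prop) : Prop := Omega1Like {
  omega1_wf : well_founded lt;
  omega1_total : forall i j, [\/ lt i j, i = j | lt j i];
  omega1_segment : forall i, countable [set j | lt j i];
  omega1_uncountable : ~ countable [set: I] }.

(** In a well-ordering of an uncountable set, the points with countably many
    predecessors form an uncountable initial segment: otherwise the least point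
    outside would have countably many predecessors as well. *)
Lemma omega1_like_exists :
  exists (I : choiceType) (lt : I -> I -> Prop), omega1_like lt.
Proof.
pose T : choiceType := (nat -> nat : choiceType).
have [R Rwo] := wochoice.well_ordering_principle T.
have Rmin (P : T -> Prop) : (exists t, P t) ->
    exists2 z, P z & forall t, P t -> R z t.
  move=> [t Pt]; have [|z [[/asboolP Pz zmin] _]] := Rwo [pred t | `[< P t >]].
    by exists t; apply/asboolP.
  by exists z => // u Pu; apply: zmin; apply/asboolP.
have Ranti s t : R s t -> R t s -> s = t.
  move=> st ts.
  apply: (@wochoice.wo_chain_antisymmetric T R predT (fun A _ => Rwo A)) => //.
  by rewrite st ts.
pose lt (s t : T) := ~ R t s.
have lt_wf : well_founded lt.
  move=> t; apply: contrapT => nt.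
  have [|z nz zmin] := Rmin (fun t => ~ Acc lt t); first by exists t.
  by apply: nz; constructor => y yz; apply: contrapT => /zmin.
pose J := [set t | countable [set s | lt s t]].
have ucJ : ~ countable J.
  move=> cJ.
  have [|z nJz zmin] := Rmin (fun t => ~ J t).
    apply: contrapT => /forallNP JT; apply: (star_unbounded_uncountable star_unboundedT).
    by apply: countableS cJ => t _; apply: contrapT => /JT.
  apply: nJz; apply: countableS cJ => t tz.
  by apply: contrapT => /zmin.
exists J, (fun s t => lt (val s) (val t)); split.
- move=> i; move: {2}(val i) (erefl (val i)) => t it.
  elim: (lt_wf t) i it => {}t _ IH i it; constructor => j; rewrite it => jt.
  exact: IH jt _ _.
- move=> i j; have [ij|/contrapT ji] := pselect (lt (val i) (val j)); first exact: Or31.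
  have [ji'|/contrapT ij] := pselect (lt (val j) (val i)); first exact: Or33.
  by apply: Or32; apply: val_inj; apply: Ranti.
- move=> [i iJ]; apply: (@countable_inj_on _ _ val _ [set s | lt s i]) => //.
  + by move=> x y _ _; apply: val_inj.
  + exact: set_mem iJ.
- move=> cI; apply: ucJ; rewrite (_ : J = val @` [set: J]); last first.
    apply/seteqP; split=> [t Jt|_ [[t tJ] _ <-]]; last exact: set_mem.
    by exists (SigSub (mem_set Jt)).
  exact: countable_image.
Qed.

(** Transfinite recursion of length omega_1: at each step only countably many
    values have been chosen. *)
Lemma omega1_recursion (I V : Type) (lt : I -> I -> Prop)
    (Q : set V -> V -> Prop) : omega1_like lt ->
  (forall C, countable C -> exists v, Q C v) ->
  exists g : I -> V, forall i, Q (g @` [set j | lt j i]) (g i).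
Proof.
move=> [wf _ seg _] QP.
have /choice[h hP] : forall C : set V, exists v, countable C -> Q C v.
  have [v0 _] := QP set0 (countable0 _) => C.
  by have [/QP[v]|nC] := pselect (countable C); [exists v|exists v0].
pose F i (rec : forall j, lt j i -> V) := h [set v | exists j (ji : lt j i), v = rec j ji].
pose g := Fix wf (fun=> V) F.
have gE i : g i = h (g @` [set j | lt j i]).
  rewrite /g Fix_eq; last first.
    move=> j r r' rr'; congr h; apply/seteqP; split=> v [k [kj ->]]; exists k, kj;
      by rewrite rr'.
  congr h; apply/seteqP; split=> [v [j [ji ->]]|_ [j ji <-]]; first by exists j.
  by exists j, ji.
exists g => i; rewrite [X in Q _ X]gE; apply: hP.
exact: countable_image.
Qed.

Lemma omega1_like_is_omega1 (I : Type) (lt : I -> I -> Prop) :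
  omega1_like lt -> is_omega1 [set: I].
Proof.
move=> o1; split=> [|U B ucB]; first exact: omega1_uncountable o1.
have [|g gP] := omega1_recursion (Q := fun C v => B v /\ ~ C v) o1.
  move=> C cC; apply: contrapT => /forallNP BC; apply: ucB.
  by apply: countableS cC => v Bv; apply: contrapT => nCv; apply: (BC v).
have gneq i j : lt i j -> g i <> g j.
  by move=> ij gij; have [_ []] := gP j; exists i.
apply/card_leP/injfunPex; exists (fun i => SigSub (mem_set (gP (val i)).1)) => //.
move=> i j _ _ /(congr1 val) /= gij; apply: val_inj.
by have [/gneq|//|/gneq] := omega1_total o1 (val i) (val j); rewrite gij.
Qed.

(** A set without such a [j] would lie in the initial segment below [i]. *)
Lemma omega1_uncountable_cofinal (I : Type) (lt : I -> I -> Prop) (S : set I) :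
  omega1_like lt -> ~ countable S -> forall i, exists2 j, S j & i = j \/ lt i j.
Proof.
move=> o1 ucS i; apply: contrapT => Si; apply: ucS.
apply: countableS (omega1_segment o1 i) => j Sj /=.
have [ij|ij|//] := omega1_total o1 i j; exfalso; apply: Si; exists j => //.
  by right.
by left.
Qed.

(** * The bounding number and omega_1 *)

(** Consider sets of selectors that pairwise differ at every member of the
    family.  For a maximal one, some member of the family is exhausted by the
    values of the selectors -- otherwise a further selector could be added --
    and sending a value of this member to the value of the same selector at
    another member is injective. *)
Lemma least_cardinal (T : Type) (P : set (set T)) :
  P !=set0 -> exists2 B, P B & forall B', P B' -> B #<= B'.
Proof.
move=> [B0 PB0].
pose sel (f : set T -> T) := forall B, P B -> B (f B).
pose indep (F : set (set T -> T)) := F `<=` sel /\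
  forall f g, F f -> F g -> forall B, P B -> f B = g B -> f = g.
have [|F [[Fsel Findep] Fmax]] := @Zorn_bigcup _ indep.
  move=> C CP Ctot; split=> [f [F /CP[+ _]]|f g [F CF Ff] [G CG Gg] B PB]; first exact.
  have [FG|GF] := Ctot F G CF CG; first by apply: (CP G CG).2 => //; apply: FG.
  by apply: (CP F CF).2 => //; apply: GF.
have [B PB BF] : exists2 B, P B & forall b, B b -> exists2 f, F f & f B = b.
  apply: contrapT => nB.
  have miss B : P B -> exists b, B b /\ forall f, F f -> f B <> b.
    move=> PB; apply: contrapT => nb; apply: nB; exists B => // b Bb.
    apply: contrapT => nf; apply: nb; exists b; split=> // f Ff fb.
    by apply: nf; exists f.
  have [t0 _] := miss B0 PB0.
  have /choice[f fP] : forall B, exists b, P B -> B b /\ forall f, F f -> f B <> b.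
    by move=> B; have [/miss[b]|] := pselect (P B); [exists b|exists t0].
  have nFf : ~ F f by move=> /(fP B0 PB0).2.
  apply: (Fmax (F `|` [set f])).
    by split=> [|sub]; [left|apply: nFf; apply: sub; right].
  split=> [g [/Fsel//|->] B /fP[]//|g h [Fg|->] [Fh|->] B PB] //.
  - exact: Findep.
  - by move=> /((fP B PB).2 g Fg).
  - by move=> /esym/((fP B PB).2 h Fh).
exists B => // B' PB'.
have /choice[s sP] : forall b : B, exists f, F f /\ f B = val b.
  by move=> b; have [f] := BF _ (set_mem (valP b)); exists f.
apply/card_le_injP.
exists (fun b => SigSub (mem_set (Fsel _ (sP b).1 B' PB'))) => b c.
move=> /(congr1 val) /= /(Findep _ _ (sP b).1 (sP c).1 _ PB') sbc.
by apply: val_inj; rewrite -(sP b).2 -(sP c).2 sbc.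
Qed.

(** In a subfamily of size omega_1 each member lies below one common function up
    to a finite shift, and one of the countably many shifts serves uncountably
    many members. *)
Lemma omega1_lt_b_bounded (S : Type) (x : S -> nat -> nat) :
  omega1_lt_b -> ~ countable [set: S] ->
  exists y, ~ countable [set s | forall n, (x s n <= y n)%N].
Proof.
move=> [T [A [B [[ucA leA] [_ leB] [_ nBA]]]]] ucS.
have /card_le_injP[f finj] := leA S [set: S] ucS.
have [y yP] : exists y, forall a, le_star (x (val (f a))) y.
  apply: contrapT => /forallNP nb; apply: nBA.
  apply: (card_le_trans (leB (range (fun a => x (val (f a)))) _)).
    move=> y; apply: contrapT => ny; apply: (nb y) => a.
    by apply: contrapT => nle; apply: ny; exists (x (val (f a))) => //; exists a.
  by apply: (card_le_trans (card_image_le _ _)); rewrite (card_le_eql (card_setT A)).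
apply: contrapT => /forallNP cy; apply: ucA.
rewrite -(eq_countable (card_setT A)).
apply: (@countableS _ _
    (\bigcup_m [set a | forall n, (x (val (f a)) n <= y n + m)%N])).
  by move=> a _; have [m mP] := le_star_shift (yP a); exists m.
apply: bigcup_countable => // m _.
have /contrapT := cy (fun n => y n + m).
apply: (@countable_inj_on _ _ (val \o f)) => // a b _ _ /val_inj; exact: finj.
Qed.

(** If [omega1_lt_b] fails then an unbounded family is indexed by [omega_1];
    letting the [i]-th function dominate all members with index up to [i] makes
    every uncountable, hence cofinal, subfamily unbounded. *)
Lemma not_omega1_lt_b_unbounded : ~ omega1_lt_b ->
  exists (I : choiceType) (x : I -> nat -> nat), ~ countable [set: I] /\
    forall S y, ~ countable S -> exists2 i, S i & ~ forall n, (x i n <= y n)%N.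
Proof.
move=> nlt; have [I [lt o1]] := omega1_like_exists.
have [|B ubB leB] := @least_cardinal _ star_unbounded.
  by exists setT; apply: star_unboundedT.
have oI := omega1_like_is_omega1 o1.
have IB : [set: I] #<= B by apply: oI.2; apply: star_unbounded_uncountable.
have /card_le_injP[f finj] : B #<= [set: I].
  by apply: contrapT => nBI; apply: nlt; exists I, setT, B.
have bound i : exists y, forall b : B,
    val (f b) = i \/ lt (val (f b)) i -> le_star (val b) y.
  have [|y yP] := @countable_le_star_bounded B
      [set b | val (f b) = i \/ lt (val (f b)) i] val; last by exists y.
  apply: (@countable_inj_on _ _ (val \o f) _ ([set i] `|` [set j | lt j i])) => //.
  - by move=> b c _ _ /val_inj/finj.
  - rewrite -bigcup2E; apply: bigcup_countable => // -[_|[_|//]] /=.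
    + exact: countable1.
    + exact: omega1_segment o1 i.
have /choice[x xP] := bound.
exists I, x; split=> [|S y ucS]; first exact: omega1_uncountable o1.
apply: contrapT => nS.
have [b Bb []] := ubB y.
pose b' : B := SigSub (mem_set Bb).
have [i Si ib] := omega1_uncountable_cofinal o1 ucS (val (f b')).
have /le_starP[m mP] := xP i b' ib.
apply/le_starP; exists m => n /mP /leq_trans; apply.
by apply: contrapT => nle; apply: nS; exists i => // /(_ n).
Qed.

(** * Compact covers indexed by the Baire space *)

(** If no finite subfamily covered [A], the complements in [A] of the finite
    unions would generate a proper filter without cluster point in [A]. *)
Lemma compact_finite_cover (T : topologicalType) (I : eqType) (A : set T)
    (D : set I) (W : I -> set T) : compact A ->
  (forall i, D i -> open (W i)) -> A `<=` \bigcup_(i in D) W i ->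
  exists2 s : seq I, (forall i, i \in s -> D i) &
    A `<=` \bigcup_(i in [set` s]) W i.
Proof.
move=> cA oW AW; apply: contrapT => nfin.
pose adm (s : seq I) := forall i, i \in s -> D i.
pose rest (s : seq I) := A `\` \bigcup_(i in [set` s]) W i.
have nrest s : adm s -> rest s !=set0.
  move=> Ds; apply: contrapT => /set0P/negP/negPn/eqP r0; apply: nfin; exists s => //.
  by move=> t At; apply: contrapT => nt; have : rest s t by []; rewrite r0.
pose F := filter_from adm rest.
have FF : ProperFilter F.
  apply: filter_from_proper => //; apply: filter_from_filter; first by exists [::].
  move=> s t Ds Dt; exists (s ++ t).
    by move=> i; rewrite mem_cat => /orP[/Ds|/Dt].
  by move=> x [Ax nx]; split; split=> // -[i si Wi]; apply: nx; exists i => //=;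
    rewrite mem_cat; apply/orP; [left|right].
have [|p [Ap clp]] := cA F FF; first by exists [::] => // x [].
have [i Di Wip] := AW _ Ap.
have [||q [[_ nq] Wq]] := clp (rest [:: i]) (W i).
- by exists [:: i] => // j; rewrite inE => /eqP->.
- by apply: open_nbhs_nbhs; split=> //; apply: oW.
- by apply: nq; exists i => //=; rewrite inE.
Qed.

Lemma compact_increasing_cover (T : topologicalType) (A : set T)
    (W : nat -> set T) : compact A -> (forall n, open (W n)) ->
  (forall m n, (m <= n)%N -> W m `<=` W n) ->
  A `<=` \bigcup_n W n -> exists n, A `<=` W n.
Proof.
move=> cA oW Wmono AW; have [//|s _ sP] := compact_finite_cover cA _ AW.
exists (\max_(i <- s) i) => t /sP[i /= si]; apply: Wmono.
exact: (@leq_bigmax_seq _ _ xpredT id).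
Qed.

Lemma compact_nested (T : topologicalType) (A U : set T) (E : nat -> set T) :
  compact A -> (forall n, closed (E n)) -> open U ->
  A `&` \bigcap_n E n `<=` U ->
  exists m, A `&` \bigcap_(n in `I_m) E n `<=` U.
Proof.
move=> cA cE oU AEU.
have [|||m mP] := @compact_increasing_cover _ A
    (fun m => U `|` ~` \bigcap_(n in `I_m) E n) cA.
- move=> m; apply: openU => //; apply: closed_openC.
  by apply: closed_bigI => n _.
- move=> m n mn t [Ut|nt]; [by left|right=> tn; apply: nt => k km].
  by apply: tn; apply: leq_trans km mn.
- move=> t At; have [Et|/existsNP[n /not_implyP[_ nEt]]] := pselect ((\bigcap_n E n) t).
    by exists 0 => //; left; apply: AEU.
  by exists n.+1 => //; right=> /(_ n (ltnSn n)).
- by exists m => t [/mP[]].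
Qed.

Definition agree (m : nat) (y z : nat -> nat) := forall n, (n < m)%N -> z n = y n.

(** Besides the classical upper semicontinuous compact-valued surjection on the
    Baire space, monotonicity is required: it is what turns a bound on indices
    into a single compact set. *)
Definition usco_resolution (X : topologicalType) (Phi : (nat -> nat) -> set X) :=
  [/\ forall y, compact (Phi y),
      forall x, exists y, Phi y x,
      forall y z, (forall n, (y n <= z n)%N) -> Phi y `<=` Phi z
    & forall y U, open U -> Phi y `<=` U ->
        exists m, forall z, agree m y z -> Phi z `<=` U].

Lemma embedding_compact_preimage (Z K : topologicalType) (e : Z -> K) (Q : set K) :
  topological_embedding e -> compact Q -> Q `<=` range e -> compact (e @^-1` Q).
Proof.
move=> [einj eo] cQ Qe F FF FQ.
have [|q [Qq clq]] := cQ (e @ F) _; first exact: FQ.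
have [z _ zq] := Qe _ Qq; exists z; split; first by rewrite /= zq.
move=> A B FA; rewrite nbhsE => -[O [oO Oz] OB].
have [V oV VO] := (eo O).1 oO.
have [||k [[a Aa <-] Vk]] := clq (e @` A) V.
- by apply: (@filterS _ F _ A) => // a Aa; exists a.
- by apply: open_nbhs_nbhs; split=> //; rewrite -zq; move: Oz; rewrite -VO.
- by exists a; split=> //; apply: OB; rewrite -VO.
Qed.

Lemma closed_prefix_union (T : topologicalType) (F : nat -> set T) m :
  (forall k, closed (F k)) -> closed (\bigcup_(k in `I_m) F k).
Proof. by move=> cF; apply: closed_bigcup => //; apply: finite_II. Qed.

(** By regularity of [K], each point of [Z] has an open neighbourhood whose
    closure in [K] lies in [G]; countably many of these cover [Z]. *)
Lemma lindelof_closed_refinement (Z K : topologicalType) (e : Z -> K) (G : set K) :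
  lindelof_space Z -> topological_embedding e -> compact [set: K] ->
  hausdorff_space K -> open G -> range e `<=` G ->
  exists F : nat -> set K, [/\ forall k, closed (F k), forall k, F k `<=` G &
    forall z, exists k, F k (e z)].
Proof.
move=> lZ [einj eo] cK hK oG eG.
pose C := [set O : set Z | open O /\
  exists F : set K, [/\ closed F, F `<=` G & e @` O `<=` F]].
have [||D [DC cD DT]] := lZ C; first by move=> O [].
  apply/seteqP; split=> // z _.
  have [||W Wz WG] := @compact_regular K (e z) setT hK cK _ G.
  - exact: filterT.
  - by apply: open_nbhs_nbhs; split=> //; apply: eG; exists z.
  exists (e @^-1` W°); last exact: Wz.
  split; first by apply/eo; exists (W°) => //; apply: open_interior.
  exists (closure W); split=> //; first exact: closed_closure.
  by move=> _ [a Wa <-]; apply: subset_closure; apply: interior_subset Wa.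
have [||F [FP DF]] := @countable_choice _ (set K) D
    (fun F => closed F /\ F `<=` G) (fun O F => e @` O `<=` F) cD.
- by exists set0; split=> //; apply: closed0.
- by move=> O /DC[_ [F [cF FG OF]]]; exists F.
exists F; split=> [k|k|z]; [by have [] := FP k|by have [] := FP k|].
have : [set: Z] z by [].
by rewrite -DT => -[O /DF[k OF] Oz]; exists k; apply: OF; exists z.
Qed.

(** Using [k <= y n] rather than [k = y n] in [E] makes the resolution monotone.
    The sets stay inside [Z] since [F n k] lies in the [n]-th open set of the
    G-delta representation; upper semicontinuity is compactness of [K] applied to
    the intersection of the [E y n]. *)
Lemma K_analytic_usco_resolution (X : topologicalType) :
  K_analytic X -> exists Phi : (nat -> nat) -> set X, usco_resolution Phi.
Proof.
move=> [Z [lZ [_ [K [e [[cK hK eE _] [G oG eG]]]]] [f cf fT]]].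
have /choice[F FP] : forall n, exists F : nat -> set K,
    [/\ forall k, closed (F k), forall k, F k `<=` G n & forall z, exists k, F k (e z)].
  move=> n; apply: lindelof_closed_refinement => //.
  by rewrite eG => k /(_ n I).
pose E y n := \bigcup_(k in `I_(y n).+1) F n k.
have cE y n : closed (E y n) by apply: closed_prefix_union; have [] := FP n.
have Ee y : \bigcap_n E y n `<=` range e.
  rewrite eG => k Ek n _; have [j _] := Ek n I.
  by have [_ + _] := FP n; apply.
pose Q y := \bigcap_n E y n.
have cQ y : compact (Q y).
  by apply: (subclosed_compact _ cK) => //; apply: closed_bigI => n _; apply: cE.
exists (fun y => f @` (e @^-1` Q y)); split.
- move=> y; apply: continuous_compact; first exact: continuous_subspaceT.
  exact: (embedding_compact_preimage eE (cQ y) (@Ee y)).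
- move=> x; have [z _ <-] : range f x by rewrite fT.
  have /choice[y yP] : forall n, exists k, F n k (e z) by move=> n; have [] := FP n.
  exists y; exists z => //= n _; exists (y n) => //=; exact: ltnSn.
- move=> y y' yy' _ [z Qz <-]; exists z => // n _.
  have [k /= ky Fk] := Qz n I; exists k => //=.
  by apply: leq_trans ky _; rewrite ltnS.
- move=> y U oU QU.
  have [V oV VU] := (eE.2 (f @^-1` U)).1 (iffLR (continuousP f) cf U oU).
  have [|m mP] := @compact_nested K setT V (E y) cK (cE y) oV.
    move=> k [_ Qk]; have [z _ zk] := Ee _ _ Qk; rewrite -zk.
    suff : (e @^-1` V) z by [].
    by rewrite VU; apply: QU; exists z => //=; rewrite zk.
  exists m => z zy _ [a Qa <-].
  suff : (e @^-1` V) a by rewrite VU.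
  apply: mP; split=> // n nm; have := Qa n I.
  by rewrite /E zy.
Qed.

(** * Metrics from sequences of pseudodistances *)

Section SupMetric.
Import Order.TTheory GRing.Theory Num.Theory.
Local Open Scope ring_scope.
Variables (R : realType) (T : choiceType) (rho : nat -> T -> T -> R).

Record pseudodistances : Prop := Pseudodistances {
  rho_ge0 : forall n x y, 0 <= rho n x y;
  rho_le : forall n x y, rho n x y <= n.+1%:R^-1;
  rhoxx : forall n x, rho n x x = 0;
  rho_sym : forall n x y, rho n x y = rho n y x;
  rho_triangle : forall n y x z, rho n x z <= rho n x y + rho n y z;
  rho_separating : forall x y, (forall n, rho n x y = 0) -> x = y }.

Hypothesis rhoP : pseudodistances.

(** The bound [1/(n+1)] on the [n]-th pseudodistance makes the supremum induce
    the topology of the whole sequence: only finitely many terms exceed a given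
    positive number. *)
Definition sup_dist x y := sup (range (fun n => rho n x y)).

Lemma le_sup_dist n x y : rho n x y <= sup_dist x y.
Proof.
apply: ub_le_sup; last by exists n.
exists 1 => _ [k _ <-]; apply: le_trans (rho_le rhoP _ _ _) _.
by rewrite invf_le1 ?ltr0n// ler1n.
Qed.

Lemma sup_dist_le e x y : (forall n, rho n x y <= e) -> sup_dist x y <= e.
Proof.
move=> le_e; apply: ge_sup; first by exists (rho 0 x y); exists 0%N.
by move=> _ [n _ <-].
Qed.

Lemma sup_dist_small e x : 0 < e -> exists N, forall y,
  (forall n, (n < N)%N -> rho n x y < e) -> sup_dist x y <= e.
Proof.
move=> e0; have [N _ NP] := near_infty_natSinv_lt (PosNum e0).
exists N => y small; apply: sup_dist_le => n.
have [/small/ltW//|Nn] := ltnP n N.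
by apply: le_trans (rho_le rhoP _ _ _) _; apply/ltW/NP.
Qed.

Definition sup_metric : Type := let _ := rhoP in T.

HB.instance Definition _ := Choice.on sup_metric.

Let sup_dist_ge0 x y : 0 <= sup_dist x y.
Proof. exact: le_trans (rho_ge0 rhoP 0 x y) (le_sup_dist 0 x y). Qed.

Let sup_distxx x : sup_dist x x = 0.
Proof.
apply/eqP; rewrite eq_le sup_dist_ge0 andbT; apply: sup_dist_le => n.
by rewrite (rhoxx rhoP).
Qed.

Let sup_dist_eq0 x y : sup_dist x y = 0 -> x = y.
Proof.
move=> xy0; apply: (rho_separating rhoP) => n; apply/eqP.
by rewrite eq_le (rho_ge0 rhoP) andbT -xy0 le_sup_dist.
Qed.

Let sup_dist_sym x y : sup_dist x y = sup_dist y x.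
Proof. by congr sup; apply: eq_imagel => n _; apply: rho_sym. Qed.

Let sup_dist_triangle y x z : sup_dist x z <= sup_dist x y + sup_dist y z.
Proof.
apply: sup_dist_le => n; apply: le_trans (rho_triangle rhoP n y x z) _.
by apply: lerD; apply: le_sup_dist.
Qed.

HB.instance Definition _ := @isMetric.Build R sup_metric sup_dist sup_distxx
  sup_dist_eq0 sup_dist_sym sup_dist_triangle.

Lemma ball_sup_metric (x y : sup_metric) e : ball x e y = (sup_dist x y < e).
Proof. by rewrite ballEmdist. Qed.

Lemma sup_metric_nbhs (x : sup_metric) (U : set sup_metric) : nbhs x U ->
  exists N e, 0 < e /\ forall y : sup_metric,
    (forall n, (n < N)%N -> rho n x y < e) -> U y.
Proof.
move=> /nbhs_ballP[e /= e0 xeU].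
have e20 : 0 < e / 2 by rewrite divr_gt0.
have [N NP] := sup_dist_small x e20; exists N, (e / 2); split=> // y /NP xy.
apply: xeU; rewrite ball_sup_metric (le_lt_trans xy)//.
by rewrite ltr_pdivrMr// ltr_pMr// ltr1n.
Qed.

Lemma nbhs_sup_metric (x : sup_metric) n e : 0 < e ->
  nbhs x [set y : sup_metric | rho n x y < e].
Proof.
move=> e0; apply/nbhs_ballP; exists e => //= y; rewrite ball_sup_metric.
by apply: le_lt_trans; apply: le_sup_dist.
Qed.

End SupMetric.

(** * Subspaces of the Baire space *)

Section BaireSubspace.
Import Order.TTheory GRing.Theory Num.Theory.
Local Open Scope ring_scope.
Variables (R : realType) (P : set (nat -> nat)).

Definition baire_rho n (w w' : P) : R :=
  if val w n == val w' n then 0 else n.+1%:R^-1.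

Lemma baire_rhoP : pseudodistances baire_rho.
Proof.
split; rewrite /baire_rho.
- by move=> n w w'; case: ifP => // _; rewrite invr_ge0.
- by move=> n w w'; case: ifP => // _; rewrite invr_ge0.
- by move=> n w; rewrite eqxx.
- by move=> n w w'; rewrite eq_sym.
- move=> n w' w w''; have i0 : 0 <= n.+1%:R^-1 :> R by rewrite invr_ge0.
  have [->|ne1] := eqVneq (val w n) (val w' n); first by rewrite add0r.
  by case: ifP => _; case: ifP => _; rewrite ?addr0 ?addr_ge0 // lerDl.
- move=> w w' ww'; apply: val_inj; apply/funext => n; have := ww' n.
  by case: eqP => // _ /eqP; rewrite invr_eq0 pnatr_eq0.
Qed.

Definition baire_subspace := sup_metric baire_rhoP.

Definition baire_point (w : baire_subspace) : nat -> nat := val (w : P).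

Lemma baire_pointP (w : baire_subspace) : P (baire_point w).
Proof. exact: set_mem (valP (w : P)). Qed.

Lemma baire_rho_lt n (w w' : P) : baire_rho n w w' < n.+1%:R^-1 -> val w' n = val w n.
Proof. by rewrite /baire_rho; case: eqP => //; rewrite ltxx. Qed.

Lemma nbhs_baire (w : baire_subspace) m :
  nbhs w [set w' | agree m (baire_point w) (baire_point w')].
Proof.
elim: m => [|m IH]; first by apply: filterS filterT => w' _ n.
have := @nbhs_sup_metric _ _ _ baire_rhoP w m m.+1%:R^-1.
rewrite invr_gt0 ltr0n => /(_ isT) near_m.
near=> w' => n; rewrite ltnS leq_eqVlt => /predU1P[->|nm].
  by apply: baire_rho_lt; near: w'.
by move: n nm; near: w'.
Unshelve. all: by end_near. Qed.

Lemma nbhs_baireE (w : baire_subspace) U : nbhs w U -> exists m,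
  forall w', agree m (baire_point w) (baire_point w') -> U w'.
Proof.
move=> /sup_metric_nbhs[m [e [e0 mU]]]; exists m => w' ww'.
by apply: mU => n /ww'; rewrite /baire_rho /baire_point => ->; rewrite eqxx.
Qed.

(** A countable dense set has one point for each finite sequence that some
    element extends. *)
Lemma baire_separable : separable_space baire_subspace.
Proof.
pose ext (s : seq nat) (w : baire_subspace) :=
  forall n, (n < size s)%N -> baire_point w n = nth 0%N s n.
have /choice[d dP] : forall s, exists o, (exists w, ext s w) ->
    exists2 w, o = Some w & ext s w.
  move=> s; have [[w sw]|nw] := pselect (exists w, ext s w).
    by exists (Some w) => _; exists w.
  by exists None => /nw.
exists [set w | exists s, d s = Some w].
  apply: (@countable_inj_on _ _ Some _ (range d)).
  - by move=> w [s sw]; exists s.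
  - by move=> w w' _ _ [].
  - by apply: countable_image.
move=> O [w Ow] oO; have /nbhs_baireE[m mO] : nbhs w O by apply: open_nbhs_nbhs.
pose s := mkseq (baire_point w) m.
have [|w' sw' ext_w'] := dP s.
  by exists w => n; rewrite size_mkseq => nm; rewrite nth_mkseq.
exists w'; split; last by exists s.
apply: mO => n nm; rewrite ext_w' ?size_mkseq//.
by rewrite nth_mkseq.
Qed.

(** The coordinates of a Cauchy filter are eventually constant, and [P] contains
    their limit as soon as it is closed. *)
Lemma baire_complete :
  (forall w, (forall m, exists2 w', P w' & agree m w w') -> P w) ->
  complete_space baire_subspace.
Proof.
move=> cP F FF /cauchyP cF.
have /choice[c cP'] : forall n, exists k, F [set w | baire_point w n = k].
  move=> n; have [|w Fw] := cF n.+1%:R^-1; first by rewrite invr_gt0.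
  exists (baire_point w n); apply: filterS Fw => w'; rewrite ball_sup_metric => ww'.
  apply: baire_rho_lt; apply: le_lt_trans ww'; apply: (le_sup_dist baire_rhoP).
have Fc m : F [set w | agree m c (baire_point w)].
  elim: m => [|m IH]; first by apply: filterS filterT => w' _ n.
  near=> w => n; rewrite ltnS leq_eqVlt => /predU1P[->|nm].
    by near: w; apply: cP'.
  by move: n nm; near: w.
have Pc : P c.
  apply: cP => m; have [w wc] := filter_ex (Fc m).
  by exists (baire_point w) => //; apply: baire_pointP.
exists (SigSub (mem_set Pc) : P) => U /nbhs_baireE[m mU].
by apply: filterS (Fc m) => w /mU.
Unshelve. all: by end_near. Qed.

End BaireSubspace.

(** * Countable networks and metrizable compact sets *)

(** A network resembles a base, but its members need not be open; therefore
    countable networks are inherited by continuous images. *)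
Definition has_countable_network (X : topologicalType) (A : set X) :=
  exists2 N : set (set X), countable N &
    forall x U, A x -> open U -> U x ->
      exists V, [/\ N V, V x & V `&` A `<=` U].

Lemma network_subset (X : topologicalType) (A B : set X) :
  A `<=` B -> has_countable_network B -> has_countable_network A.
Proof.
move=> AB [N cN NP]; exists N => // x U /AB Bx oU Ux.
have [V [NV Vx VU]] := NP x U Bx oU Ux; exists V; split=> // y [Vy /AB By].
exact: VU.
Qed.

Lemma network_countable (X : topologicalType) (A : set X) :
  countable A -> has_countable_network A.
Proof.
move=> cA; exists (set1 @` A); first exact: countable_image.
move=> x U Ax oU Ux; exists [set x]; split=> [| |y [->//]] //.
Qed.

Lemma network_image (Z X : topologicalType) (f : Z -> X) :
  continuous f -> has_countable_network [set: Z] -> has_countable_network (range f).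
Proof.
move=> cf [N cN NP]; exists (image^~ f @` N); first exact: countable_image.
move=> _ U [z _ <-] oU Uz.
have [V [NV Vz VU]] := NP z (f @^-1` U) I (iffLR (continuousP f) cf U oU) Uz.
exists (f @` V); split; [by exists V|by exists z|].
by move=> _ [[a Va <-] _]; apply: VU.
Qed.

(** A network contains the singleton of every isolated point. *)
Lemma network_isolated_points (X : topologicalType) :
  has_countable_network [set: X] -> countable (isolated [set: X]).
Proof.
move=> [N cN NP].
apply: (@countable_inj_on _ _ set1 _ N) => //.
  move=> x [_ [U xU]]; rewrite setIT => Ux.
  move: xU; rewrite nbhsE => -[O [oO Ox] OU].
  have [V [NV Vx VO]] := NP x O I oO Ox.
  suff <- : V = [set x] by [].
  apply/seteqP; split=> [y Vy|y ->//].
  by rewrite -Ux; apply/OU/VO.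
by move=> x y _ _ xy; have : [set x] x by []; rewrite xy.
Qed.

Section MetricNetwork.
Import Order.TTheory GRing.Theory Num.Theory numFieldNormedType.Exports.
Local Open Scope ring_scope.
Variables (R : realType) (M : metricType R).

Lemma separable_metric_network : separable_space M -> has_countable_network [set: M].
Proof.
move=> [D cD dD].
exists ((fun p : M * nat => ball p.1 p.2.+1%:R^-1) @` (D `*` setT)).
  by apply: countable_image; apply: countableX.
move=> x U _ oU Ux.
have /nbhs_ballP[e /= e0 xeU] : nbhs x U by apply: open_nbhs_nbhs.
have e20 : 0 < e / 2 by rewrite divr_gt0.
have [N _ NP] := near_infty_natSinv_lt (PosNum e20).
have {NP} Ne : N.+1%:R^-1 < e / 2 by apply: NP => /=.
have N0 : (0 : R) < N.+1%:R^-1 by rewrite invr_gt0 ltr0n.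
have [||c [xc Dc]] := dD ((ball x N.+1%:R^-1)°).
- by exists x; apply: nbhsx_ballx.
- exact: open_interior.
exists (ball c N.+1%:R^-1); split.
- by exists (c, N).
- by apply: ball_sym; apply: interior_subset xc.
- move=> y [cy _]; apply: xeU; rewrite (splitr e).
  apply: (@ball_triangle _ _ c).
    by apply: le_ball (ltW Ne) _ _; apply: interior_subset xc.
  by apply: le_ball (ltW Ne) _ _.
Qed.

Lemma compact_metric_separable : compact [set: M] -> separable_space M.
Proof.
move=> cM.
have /choice[s sP] : forall n : nat, exists s : seq M,
    forall x, exists2 c, c \in s & ball c n.+1%:R^-1 x.
  move=> n; have n0 : (0 : R) < n.+1%:R^-1 by rewrite invr_gt0 ltr0n.
  have [|x _|t _ tP] := @compact_finite_cover M M setT setT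
      (fun c => (ball c n.+1%:R^-1)°) cM.
  - by move=> c _; apply: open_interior.
  - by exists x => //; apply: nbhsx_ballx.
  - by exists t => x; have [//|c tc /interior_subset xc] := tP x; exists c.
exists (\bigcup_n [set` s n]).
  by apply: bigcup_countable => // n _; apply: finite_set_countable; apply: finite_seq.
move=> O [x Ox] oO.
have /nbhs_ballP[e /= e0 xeO] : nbhs x O by apply: open_nbhs_nbhs.
have [N _ NP] := near_infty_natSinv_lt (PosNum e0).
have {NP} Ne : N.+1%:R^-1 < e by apply: NP => /=.
have [c sc cx] := sP N x; exists c; split; last by exists N.
by apply: xeO; apply: ball_sym; apply: le_ball (ltW Ne) _ cx.
Qed.

End MetricNetwork.

Lemma analytic_network (R : realType) (X : topologicalType) :
  analytic R X -> has_countable_network [set: X].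
Proof.
move=> [Z [M [h [sM _ [_ [k [ck hk kh]]]]]] [f cf <-]].
apply: network_image => //.
have <- : range k = setT by apply/seteqP; split=> // z _; exists (h z).
by apply: network_image => //; apply: separable_metric_network.
Qed.

Lemma compact_subtype (X : topologicalType) (K : set X) :
  compact K -> compact [set: K].
Proof.
move=> cK; have <- : val @^-1` K = [set: K].
  by apply/seteqP; split=> // x _; apply: set_mem (valP x).
apply: embedding_compact_preimage => //.
by move=> x Kx; exists (SigSub (mem_set Kx)).
Qed.

Lemma subtype_val_continuous (X : topologicalType) (K : set X) :
  continuous (val : K -> X).
Proof. exact: initial_continuous. Qed.

Lemma range_val (T : Type) (K : set T) : range (val : K -> T) = K.
Proof.
apply/seteqP; split=> [_ [x _ <-]|x Kx]; first exact: set_mem (valP x).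
by exists (SigSub (mem_set Kx)).
Qed.

Lemma compact_metrizable_network (R : realType) (X : topologicalType) (K : set X) :
  compact K -> metrizable R K -> has_countable_network K.
Proof.
move=> /compact_subtype cK [M [h [ch [k [ck hk kh]]]]].
rewrite -(range_val K); apply: network_image; first exact: subtype_val_continuous.
have <- : range k = setT by apply/seteqP; split=> // z _; exists (h z).
apply: network_image => //; apply/separable_metric_network/compact_metric_separable.
have -> : [set: M] = range h by apply/seteqP; split=> // z _; exists (k z).
by apply: continuous_compact => //; apply: continuous_subspaceT.
Qed.

Lemma network_subtype (X : topologicalType) (K : set X) :
  has_countable_network K -> has_countable_network [set: K].
Proof.
move=> [N cN NP]; exists ((fun V => val @^-1` V) @` N); first exact: countable_image.
move=> x _ _ [U oU <-] Ux.
have [V [NV Vx VU]] := NP (val x) U (set_mem (valP x)) oU Ux.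
exists (val @^-1` V); split=> //; first by exists V.
by move=> y [Vy _]; apply: VU; split=> //; apply: set_mem (valP y).
Qed.

Lemma hausdorff_injective (X Y : topologicalType) (f : X -> Y) :
  continuous f -> injective f -> hausdorff_space Y -> hausdorff_space X.
Proof.
move=> cf finj hY x y xy; apply/finj/hY => A B /cf xA /cf yB.
by have [z [Az Bz]] := xy _ _ xA yB; exists (f z).
Qed.

Section SeparatingFunctions.
Import Order.TTheory GRing.Theory Num.Theory numFieldNormedType.Exports.
Local Open Scope ring_scope.
Variables (R : realType) (Y : topologicalType) (f : nat -> Y -> R).
Hypotheses (f01 : forall n y, 0 <= f n y <= 1)
  (fsep : forall y z, (forall n, f n y = f n z) -> y = z).

Definition fun_rho n y z : R := `|f n y - f n z| / n.+1%:R.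

Lemma fun_rhoP : pseudodistances fun_rho.
Proof.
have i0 n : (0 : R) <= n.+1%:R^-1 by rewrite invr_ge0.
split; rewrite /fun_rho.
- by move=> n y z; rewrite mulr_ge0.
- move=> n y z; rewrite ler_piMl//.
  by rewrite ler_distl; have := f01 n y; have := f01 n z; lra.
- by move=> n y; rewrite subrr normr0 mul0r.
- by move=> n y z; rewrite distrC.
- by move=> n y x z; rewrite -mulrDl ler_wpM2r// ler_distD.
- move=> y z yz; apply: fsep => n; apply/eqP; rewrite -subr_eq0 -normr_eq0.
  by have /eqP := yz n; rewrite mulf_eq0 invr_eq0 pnatr_eq0 orbF.
Qed.

(** The metric defined by the functions is coarser than the topology of [Y], and
    a continuous bijection from a compact space onto a Hausdorff space is a
    homeomorphism. *)
Lemma compact_separating_metrizable :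
  compact [set: Y] -> (forall n, continuous (f n)) -> metrizable R Y.
Proof.
move=> cY cf.
pose M : metricType R := sup_metric fun_rhoP.
pose h (y : Y) : M := y; pose k (m : M) : Y := m.
have ch : continuous h.
  move=> y U /sup_metric_nbhs[N [e [e0 NU]]]; rewrite /h.
  have near_n n : \forall z \near y, fun_rho n y z < e.
    have := cf n y; move=> /cvgrPdist_lt /(_ e e0); apply: filterS => z yz.
    rewrite /fun_rho (le_lt_trans _ yz)// ler_piMr//.
    by rewrite invf_le1 ?ltr0n// ler1n.
  have near_N : forall m, \forall z \near y, forall n, (n < m)%N -> fun_rho n y z < e.
    elim=> [|m IH]; first by apply: filterS filterT => z _ n.
    near=> z => n; rewrite ltnS leq_eqVlt => /predU1P[->|nm].
      by near: z; apply: near_n.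
    by move: n nm; near: z.
  by apply: filterS (near_N N) => z /NU.
exists M, h; split=> //; exists k; split=> //.
apply/continuousP => U oU.
rewrite -[_ @^-1` _]setCK; apply: closed_openC.
have -> : ~` (k @^-1` U) = h @` (~` U).
  by apply/seteqP; split=> [m nUm|_ [y nUy <-]]; [exists m|].
apply: compact_closed; first exact: metric_hausdorff.
apply: continuous_compact; first exact: continuous_subspaceT.
by apply: (subclosed_compact _ cY) => //; apply: open_closedC.
Unshelve. all: by end_near. Qed.

End SeparatingFunctions.

Section NetworkMetrization.
Import Order.TTheory GRing.Theory Num.Theory numFieldNormedType.Exports.
Local Open Scope ring_scope.
(** For each pair of members of the network with disjoint closures a Urysohn
    function is chosen; by regularity two points have neighbourhoods, hence
    members of the network, with disjoint closures. *)
Lemma compact_network_metrizable (R : realType) (Y : topologicalType) :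
  compact [set: Y] -> hausdorff_space Y -> has_countable_network [set: Y] ->
  metrizable R Y.
Proof.
move=> cY hY [N cN NP].
have nY := compact_normal hY cY.
pose A := [set p : set Y * set Y | (N `*` N) p /\ closure p.1 `&` closure p.2 = set0].
have cA : countable A by apply: (@countableS _ _ (N `*` N)); [move=> p []|apply: countableX].
have [||f [fc fA]] := @countable_choice _ (Y -> R) A
    (fun f => continuous f /\ forall y, 0 <= f y <= 1)
    (fun p f => (forall y, p.1 y -> f y = 0) /\ (forall y, p.2 y -> f y = 1)) cA.
- exists (fun=> 0); split=> [y|y]; first exact: cst_continuous.
  by rewrite lexx ler01.
- move=> [V W] [_ /= VW0].
  have sepVW := iffLR (@normal_separatorP R Y) nY _ _
    (@closed_closure _ V) (@closed_closure _ W) VW0.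
  have [g [cg g01 gV gW]] := iffLR (@uniform_separatorP Y R _ _) sepVW.
  exists g; split=> //.
  + by move=> y; have := g01 (g y); rewrite /= in_itv /=; apply; exists y.
  + by move=> y Vy; apply: gV; exists y => //; apply: subset_closure.
  + by move=> y Wy; apply: gW; exists y => //; apply: subset_closure.
have shrink y U : open U -> U y -> exists V, [/\ N V, V y & closure V `<=` U].
  move=> oU Uy.
  have [||W yW WU] := @compact_regular Y y setT hY cY _ U.
  - exact: filterT.
  - exact: open_nbhs_nbhs.
  have [V [NV Vy VW]] := NP y W° I (open_interior W) yW.
  exists V; split=> //; apply: subset_trans WU; apply: closureS => z Vz.
  by apply: interior_subset; apply: VW.
apply: (@compact_separating_metrizable R Y f) => //.
- by move=> n; apply: (fc n).2.
- move=> y z fyz; apply: contrapT => yz.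
  have := hY; rewrite open_hausdorff => /(_ y z).
  move=> -[|[U W] /= [/set_mem Uy /set_mem Wz] [oU oW UW]]; first exact/eqP.
  have [V [NV Vy VU]] := shrink y U oU Uy.
  have [V' [NV' Vz VW]] := shrink z W oW Wz.
  have [|n [fV fV']] := fA (V, V').
    split=> //=; apply/seteqP; split=> // t [/VU Ut /VW Wt].
    by rewrite -(eqP UW).
  by have := fyz n; rewrite fV// fV'// => /esym/eqP; rewrite oner_eq0.
- by move=> n; apply: (fc n).1.
Qed.
End NetworkMetrization.

Lemma compact_subset_metrizable (R : realType) (X : topologicalType) (K : set X) :
  hausdorff_space X -> compact K -> has_countable_network K -> metrizable R K.
Proof.
move=> hX cK nK; apply: compact_network_metrizable.
- exact: compact_subtype.
- apply: hausdorff_injective hX; first exact: subtype_val_continuous.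
  by move=> x y; apply: val_inj.
- exact: network_subtype.
Qed.

(** * Consequences of omega_1 < b *)

(** Uncountably many points would have indices below a single [z], hence lie in
    the countable set [Phi z]. *)
Lemma omega1_lt_b_countable (X : topologicalType) (Phi : (nat -> nat) -> set X) :
  omega1_lt_b -> usco_resolution Phi -> (forall y, countable (Phi y)) ->
  countable [set: X].
Proof.
move=> lt_b [_ cover mono _] cPhi; apply: contrapT => ucX.
have /choice[y yP] := cover.
have [z] := omega1_lt_b_bounded y lt_b ucX; apply.
by apply: countableS (cPhi z) => x xz; apply: mono xz _ (yP x).
Qed.

(** If no countable family of pairs of disjoint open sets separates the points,
    recursion yields [omega_1] pairs of points [(a i, b i)] with open boxes
    around them such that no pair lies in an earlier box.  Some [Phi z] contains
    uncountably many of the points [a i], [b i], and two of these pairs cannot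
    be surrounded within their boxes by the same pair of members of a countable
    network of [Phi z]. *)
Lemma omega1_lt_b_separating (X : topologicalType) (Phi : (nat -> nat) -> set X) :
  omega1_lt_b -> hausdorff_space X -> usco_resolution Phi ->
  (forall y, has_countable_network (Phi y)) ->
  exists C : set (set X * set X), [/\ countable C,
    forall p, C p -> [/\ open p.1, open p.2 & p.1 `&` p.2 = set0]
    & forall x y, x <> y -> exists2 p, C p & p.1 x /\ p.2 y].
Proof.
move=> lt_b hX [_ cover mono _] nPhi; apply: contrapT => nsep.
have [I [lt o1]] := omega1_like_exists.
pose good (v : (X * X) * (set X * set X)) :=
  [/\ open v.2.1, open v.2.2, v.2.1 `&` v.2.2 = set0, v.2.1 v.1.1 & v.2.2 v.1.2].
pose Q (C : set ((X * X) * (set X * set X))) v :=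
  good v /\ forall w, C w -> good w -> ~ (w.2.1 v.1.1 /\ w.2.2 v.1.2).
have [|g gP] := omega1_recursion (Q := Q) o1.
  move=> C cC; apply: contrapT => /forallNP nv; apply: nsep.
  exists (snd @` (C `&` good)); split.
  - by apply/countable_image/countableS/cC => v [].
  - by move=> _ [v [_ []] ? ? ? _ _ <-].
  - move=> x y xy; apply: contrapT => nC.
    have := hX; rewrite open_hausdorff => /(_ x y).
    move=> -[|[U V] /= [/set_mem Ux /set_mem Vy] [oU oV /eqP UV]]; first exact/eqP.
    apply: (nv ((x, y), (U, V))); split=> //= w Cw gw wxy.
    by apply: nC; exists w.2 => //; exists w.
have /choice[y yP] : forall i, exists y, Phi y (g i).1.1 /\ Phi y (g i).1.2.
  move=> i; have [u ua] := cover (g i).1.1; have [v vb] := cover (g i).1.2.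
  (* Monotonicity provides one compact set containing both points. *)
  exists (fun n => maxn (u n) (v n)); split.
    by apply: mono ua => n; apply: leq_maxl.
  by apply: mono vb => n; apply: leq_maxr.
have [z] := omega1_lt_b_bounded y lt_b (omega1_uncountable o1); apply.
have [N cN NP] := nPhi z.
pose box i (p : set X * set X) := [/\ (N `*` N) p, p.1 (g i).1.1, p.2 (g i).1.2,
  p.1 `&` Phi z `<=` (g i).2.1 & p.2 `&` Phi z `<=` (g i).2.2].
pose S := [set i | forall n, (y i n <= z n)%N].
have Sz i : S i -> Phi z (g i).1.1 /\ Phi z (g i).1.2.
  by move=> Si; have [ya yb] := yP i; split; apply: mono Si _ _.
have /choice[p pP] : forall i, exists p, S i -> box i p.
  move=> i; have [Si|] := pselect (S i); last by exists (set0, set0).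
  have [[oU oV _ Ua Vb] _] := gP i; have [za zb] := Sz i Si.
  have [U [NU aU UU]] := NP _ _ za oU Ua; have [V [NV bV VV]] := NP _ _ zb oV Vb.
  by exists (U, V).
apply: (@countable_inj_on _ _ p _ (N `*` N)); first by move=> i /pP[].
  have pneq i j : S i -> S j -> lt i j -> p i <> p j.
    move=> Si Sj ij pij; have [_ /(_ (g i))[||]] := gP j; [by exists i|by have [] := gP i|].
    have [_ _ _ aU bV] := pP i Si; have [_ ja jb _ _] := pP j Sj.
    have [za zb] := Sz j Sj.
    by split; [apply: aU|apply: bV]; rewrite pij.
  move=> i j Si Sj pij; have [ij|//|ji] := omega1_total o1 i j.
    by have := pneq i j Si Sj ij.
  by have := pneq j i Sj Si ji; rewrite pij.
exact: countableX.
Qed.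

(** The halves of the values of a sequence [w] form an element [y] of the Baire
    space, and their parities choose, for each [n], one of two closed sets
    covering [X].  The intersection of the chosen sets with [Phi y] has at most
    one point; upper semicontinuity makes the set of the sequences for which it
    has one closed, and the decoding continuous. *)
Section Coding.
Variables (R : realType) (X : topologicalType) (Phi : (nat -> nat) -> set X).
Variables (D : bool -> nat -> set X).
Hypotheses (uPhi : usco_resolution Phi) (cD : forall b n, closed (D b n))
  (DT : forall n x, D true n x \/ D false n x)
  (Dsep : forall x y, x <> y -> exists n, ~ D true n x /\ ~ D false n y).

Definition halves (w : nat -> nat) n := (w n)./2.

Definition coded w := Phi (halves w) `&` \bigcap_n D (odd (w n)) n.

Lemma coded_subset1 w x y : coded w x -> coded w y -> x = y.
Proof.
move=> [_ wx] [_ wy]; apply: contrapT => xy.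
have [n [nx ny]] := Dsep xy.
by have := wx n I; have := wy n I; case: (odd (w n)).
Qed.

Lemma coded_surj x : exists w, coded w x.
Proof.
have [_ cover _ _] := uPhi; have [y yx] := cover x.
have /choice[b bP] : forall n, exists b, D b n x.
  by move=> n; case: (DT n x); [exists true|exists false].
have hE n : (b n + (y n).*2)./2 = y n by rewrite half_bit_double.
exists (fun n => b n + (y n).*2)%N; split=> [|n _].
  by rewrite /halves (_ : (fun n => _) = y)//; apply/funext.
by rewrite oddD odd_double addbF oddb.
Qed.

(** Compactness of [Phi (halves w)] replaces the infinite intersection of closed sets by
    a finite one, up to the open set [U]; the finite one is given by finitely
    many values of [w]. *)
Lemma coded_usc w U : open U -> coded w `<=` U ->
  exists m, forall w', agree m w w' -> coded w' `<=` U.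
Proof.
move=> oU wU; have [cPhi _ _ usc] := uPhi.
have [|m mP] := @compact_nested X (Phi (halves w)) U (fun n => D (odd (w n)) n)
  (cPhi _) _ oU wU; first by move=> n; apply: cD.
pose E := \bigcap_(n in `I_m) D (odd (w n)) n.
have oE : open (U `|` ~` E).
  by apply: openU => //; apply: closed_openC; apply: closed_bigI => n _; apply: cD.
have [|k kP] := usc (halves w) _ oE.
  by move=> x Px; have [Ex|] := pselect (E x); [left; apply: mP|right].
exists (maxn m k) => w' ww' x [Px Dx].
have ww'n n : (n < m)%N -> w' n = w n.
  by move=> nm; apply: ww'; apply: leq_trans nm (leq_maxl _ _).
have [|//|] := kP (halves w') _ x Px.
  by move=> n nk; rewrite /halves ww'//; apply: leq_trans nk (leq_maxr _ _).
by case=> n nm; rewrite -ww'n//; apply: Dx.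
Qed.

Lemma coding_analytic : analytic R X.
Proof.
pose P := [set w | coded w !=set0].
have cP w : (forall m, exists2 w', P w' & agree m w w') -> P w.
  move=> wP; apply: contrapT => nw.
  have [|m mP] := @coded_usc w set0 open0; first by move=> x wx; apply: nw; exists x.
  by have [w' [x w'x] /mP/(_ x w'x)] := wP m.
have /choice[f fP] : forall w : baire_subspace R P, exists x, coded (baire_point w) x.
  by move=> w; apply: (baire_pointP w).
exists (baire_subspace R P : metricType R).
  exists (baire_subspace R P : metricType R), id; split.
  - exact: baire_separable.
  - exact: baire_complete.
  - by split; [move=> x; exact: cvg_id|exists id; split=> // x; exact: cvg_id].
exists f.
  move=> w V; rewrite nbhsE => -[U [oU Uw] UV].
  have [|m mP] := @coded_usc (baire_point w) U oU.
    by move=> x wx; rewrite (coded_subset1 wx (fP w)).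
  by apply: filterS (nbhs_baire w m) => w' /mP w'U; apply/UV/w'U.
apply/seteqP; split=> // x _; have [w wx] := coded_surj x.
have Pw : P w by exists x.
pose v : baire_subspace R P := SigSub (mem_set Pw) : set_type P.
by exists v => //; apply: (@coded_subset1 w); first exact: (fP v).
Qed.

End Coding.

Lemma omega1_lt_b_analytic (R : realType) (X : topologicalType)
    (Phi : (nat -> nat) -> set X) :
  omega1_lt_b -> hausdorff_space X -> usco_resolution Phi ->
  (forall y, has_countable_network (Phi y)) -> analytic R X.
Proof.
move=> lt_b hX uPhi nPhi.
have [C [cC CP Csep]] := omega1_lt_b_separating lt_b hX uPhi nPhi.
have [||p [pP pC]] := @countable_choice _ (set X * set X) C
    (fun p => [/\ open p.1, open p.2 & p.1 `&` p.2 = set0]) (fun p q => q = p) cC.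
- by exists (set0, set0); split; [exact: open0|exact: open0|rewrite setI0].
- by move=> q Cq; exists q => //; apply: CP.
apply: (@coding_analytic R X Phi
  (fun b n => ~` (if b then (p n).1 else (p n).2)) uPhi).
- by move=> b n; apply: open_closedC; have [? ? _] := pP n; case: b.
- move=> n x; have [_ _ pn0] := pP n.
  have [px|] := pselect ((p n).1 x); [right=> qx|by left].
  by have : set0 x by rewrite -pn0.
- move=> x y /Csep[q /pC[n pn] [qx qy]]; exists n; rewrite pn.
  by split; apply.
Qed.

Lemma network_isolated_complement_countable (X : topologicalType) :
  has_countable_network [set: X] -> unique_non_isolated_point X ->
  countable [set: X].
Proof.
move=> /network_isolated_points cI [x [_ xuniq]].
apply: (@countableS _ _ (\bigcup_n bigcup2 (isolated [set: X]) [set x] n)).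
  move=> y _; rewrite bigcup2E.
  by have [|/xuniq] := pselect (isolated [set: X] y); [left|right].
by apply: bigcup_countable => // -[|[|n]] _ /=.
Qed.

(** * A K-analytic space with one non-isolated point *)

Section KSigmaDelta.
Variables (K : uniformType) (K1 : set K) (F : nat -> nat -> set K).
Hypotheses (cK : compact [set: K]) (hK : hausdorff_space K) (cK1 : closed K1)
  (cF : forall n k, closed (F n k)) (oF : forall n, open (\bigcup_k F n k)).

Definition ksigmadelta := K1 `&` \bigcap_n \bigcup_k F n k.

Local Notation Z := ksigmadelta.

(** The closure of the set in [K] is a compactification, in which the set is
    the intersection of the traces of the open sets [bigcup_k F n k]. *)
Lemma ksigmadelta_cech_complete (R : realType) : cech_complete Z.
Proof.
split; first split.
- apply: hausdorff_injective hK; first exact: subtype_val_continuous.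
  by move=> x y; apply: val_inj.
- exact: (@uniform_completely_regular R).
have Zcl (z : Z) : val z \in closure Z.
  by apply/mem_set/subset_closure; apply: set_mem (valP z).
pose e (z : Z) : closure Z := SigSub (Zcl z).
exists (closure Z), e; split; first split.
- by apply: compact_subtype; apply: (subclosed_compact _ cK) => //; apply: closed_closure.
- apply: hausdorff_injective hK; first exact: subtype_val_continuous.
  by move=> x y; apply: val_inj.
- split=> [x y /(congr1 val) xy|U]; first by apply: val_inj; apply: xy.
  split=> [[W oW WU]|[V [W oW WV] VU]].
    by exists (val @^-1` W); [exists W|].
  by exists W => //; rewrite -VU -WV.
- move=> O [p Op] [W oW WO]; have Wp : W (val p) by rewrite -WO in Op.
  have [z [Zz Wz]] := set_mem (valP p) W (open_nbhs_nbhs (conj oW Wp)).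
  exists (e (SigSub (mem_set Zz))); split; first by rewrite -WO.
  by exists (SigSub (mem_set Zz)).
exists (fun n => val @^-1` (\bigcup_k F n k)) => [n|].
  by exists (\bigcup_k F n k).
apply/seteqP; split=> [_ [z _ <-] n _|p pF].
  by have [_ /(_ n I)] := set_mem (valP z).
have Zp : Z (val p).
  split=> //.
  apply: cK1; move: (set_mem (valP p)); apply: closure_subset; apply: subIsetl.
pose z : Z := SigSub (mem_set Zp).
by exists z => //; apply: val_inj.
Qed.

(** The compact sets [K1 `&` bigcap_n F n (y n)] cover the space.  Finitely many
    members of an open cover contain one of them, and, by compactness, even the
    larger set given by a finite initial segment [s] of [y]; there are only
    countably many [s]. *)
Lemma ksigmadelta_lindelof : lindelof_space Z.
Proof.
move=> C oC CT.
pose E (s : seq nat) := K1 `&` \bigcap_(n in `I_(size s)) F n (nth 0 s n).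
have /choice[l lP] : forall s, exists l : seq (set Z), (forall U, U \in l -> C U) /\
    ((exists l' : seq (set Z), (forall U, U \in l' -> C U) /\
      val @^-1` E s `<=` \bigcup_(U in [set` l']) U) ->
    val @^-1` E s `<=` \bigcup_(U in [set` l]) U).
  move=> s; have [[l' [lC lE]]|nl] := pselect (exists l' : seq (set Z),
    (forall U, U \in l' -> C U) /\ val @^-1` E s `<=` \bigcup_(U in [set` l']) U).
    by exists l'.
  by exists [::]; split=> // /nl.
exists (\bigcup_s [set` l s]); split.
- by move=> U [s _ /= /(lP s).1].
- by apply: bigcup_countable => // s _; apply: finite_set_countable; apply: finite_seq.
apply/seteqP; split=> // z _.
have [zK1 zF] := set_mem (valP z).
have /choice[y yP] : forall n, exists k, F n k (val z).
  by move=> n; have [k _ zk] := zF n I; exists k.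
have /choice[W WP] : forall U, exists W : set K, C U -> open W /\ val @^-1` W = U.
  move=> U; have [/oC[W oW WU]|nC] := pselect (C U); first by exists W.
  by exists set0 => /nC.
have cY : compact (K1 `&` \bigcap_n F n (y n)).
  apply: (subclosed_compact _ cK) => //; apply: closedI => //.
  by apply: closed_bigI => n _; apply: cF.
have [||l' lC lE] := @compact_finite_cover _ _ _ C W cY.
- by move=> U /WP[].
- move=> p [pK1 pF].
  have Zp : Z p by split=> // n _; exists (y n) => //; apply: pF.
  have : [set: Z] (SigSub (mem_set Zp)) by [].
  rewrite -CT => -[U CU Up]; exists U => //.
  by have [_ WU] := WP U CU; rewrite -WU in Up.
have [||||m mP] := @compact_nested K K1 (\bigcup_(U in [set` l']) W U) (fun n => F n (y n)).
- exact: (subclosed_compact _ cK).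
- by move=> n; apply: cF.
- by apply: bigcup_open => U /lC/WP[].
- exact: lE.
have Es : E (mkseq y m) = K1 `&` \bigcap_(n in `I_m) F n (y n).
  rewrite /E size_mkseq; congr (_ `&` _); apply: eq_bigcapr => n nm.
  by rewrite nth_mkseq.
have [||U lU Uz] := (lP (mkseq y m)).2 _ z.
- exists l'; split=> // p Ep; have : E (mkseq y m) (val p) by [].
  rewrite Es => /mP[U lU Wp]; exists U => //.
  by have [_ <-] := WP U (lC U lU).
- by suff : E (mkseq y m) (val z) by []; rewrite Es; split=> // n _; apply: yP.
- by exists U => //; exists (mkseq y m).
Qed.

End KSigmaDelta.

(** The points [Some i] are isolated, and a set containing the point [None] at
    infinity is open when, for each [y], it omits only finitely many of the [i]
    such that [x i] is below [y] on some initial segment.  So the sets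
    [{i | x i <= y}] are compact once [None] is added, and the initial segment
    expresses upper semicontinuity in [y]. *)
Definition fan (I : choiceType) (x : I -> nat -> nat) : Type := option I.

Section Fan.
Variables (I : choiceType) (x : I -> nat -> nat).

Definition below n (y : nat -> nat) := [set i | forall k, (k < n)%N -> (x i k <= y k)%N].

Definition fan_open (U : set (fan x)) :=
  U None -> forall y, exists n, finite_set (below n y `&` [set i | ~ U (Some i)]).

Lemma below_le m n y : (m <= n)%N -> below n y `<=` below m y.
Proof. by move=> mn i yi k km; apply: yi; apply: leq_trans km mn. Qed.

Let fan_openT : fan_open setT.
Proof. by move=> _ y; exists 0; apply: sub_finite_set (finite_set0 I) => i [_ []]. Qed.

Let fan_openI : setI_closed fan_open.
Proof.
move=> U V oU oV [/oU {}oU /oV {}oV] y.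
have [m Um] := oU y; have [n Vn] := oV y; exists (maxn m n).
apply: (@sub_finite_set _ _ ((below m y `&` [set i | ~ U (Some i)]) `|`
  (below n y `&` [set i | ~ V (Some i)]))); last by rewrite finite_setU.
move=> i [yi /= /not_andP[nU|nV]]; [left|right]; split=> //.
  by apply: below_le yi; apply: leq_maxl.
by apply: below_le yi; apply: leq_maxr.
Qed.

Let fan_open_bigcup (J : Type) (f : J -> set (fan x)) :
  (forall j, fan_open (f j)) -> fan_open (\bigcup_j f j).
Proof.
move=> fo [j _ fj] y; have [n fn] := fo j fj y; exists n.
by apply: sub_finite_set fn => i [yi /= nf]; split=> //= fji; apply: nf; exists j.
Qed.

HB.instance Definition _ := Choice.on (fan x).
HB.instance Definition _ := isOpenTopological.Build (fan x)
  fan_openT fan_openI fan_open_bigcup.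

Lemma fan_openE (U : set (fan x)) : open U = fan_open U. Proof. by []. Qed.

Lemma fan_open_isolated (i : I) : open ([set Some i] : set (fan x)).
Proof. by rewrite fan_openE. Qed.

Lemma fan_open_cofinite (i : I) : open (~` [set Some i] : set (fan x)).
Proof.
move=> _ y; exists 0; apply: sub_finite_set (finite_set1 i) => j [_ /= /contrapT].
by case.
Qed.

Lemma fan_hausdorff : hausdorff_space (fan x).
Proof.
have cl i (p : fan x) : p != Some i -> exists AB : set (fan x) * set (fan x),
    (p \in AB.1 /\ Some i \in AB.2) /\ [/\ open AB.1, open AB.2 & AB.1 `&` AB.2 == set0].
  move=> /eqP pi; exists (~` [set Some i], [set Some i]); rewrite /= !inE; split=> //.
  by split; [exact: fan_open_cofinite|exact: fan_open_isolated|rewrite setICl].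
rewrite open_hausdorff => p q; case: q => [i /cl [AB [[? ?] ?]]|]; first by exists AB.
case: p => [i|/eqP//]; rewrite eq_sym => /cl[[A B] /= [[pA qB] [oA oB AB]]].
by exists (B, A) => //=; split=> //; rewrite setIC.
Qed.

(** Were [None] isolated, each [x i] would have an initial segment that
    dominates only finitely many members of the family, and the countably many
    initial segments would exhaust [I]. *)
Lemma fan_unique_non_isolated :
  ~ countable [set: I] -> unique_non_isolated_point (fan x).
Proof.
move=> ucI; exists None; split=> [[_ [V nV]]|[i|//] []]; last first.
  split; first by rewrite inE.
  exists [set Some i]; last by rewrite setIT.
  by apply: open_nbhs_nbhs; split=> //; apply: fan_open_isolated.
rewrite setIT => V0; move: nV; rewrite {}V0 nbhsE => -[U [oU U0] UV].
apply: ucI; pose S (s : seq nat) := below (size s) (nth 0 s).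
apply: (@countableS _ _ (\bigcup_(s in [set s | finite_set (S s)]) S s)); last first.
  by apply: bigcup_countable => // s /= fs; apply: finite_set_countable.
move=> i _; have [n fn] := oU U0 (x i).
have Sn : S (mkseq (x i) n) = below n (x i).
  rewrite /S size_mkseq; apply/seteqP; split=> j ji k kn; have := ji k kn;
    by rewrite nth_mkseq.
exists (mkseq (x i) n); last by rewrite Sn.
rewrite /= Sn; apply: sub_finite_set fn => j jn; split=> //= /UV; by [].
Qed.

(** A pointwise unbounded compact set would contain points [c j] whose values
    at some coordinate tend to infinity; these form a closed discrete set. *)
Lemma fan_compact_bounded (K : set (fan x)) : compact K ->
  exists y, forall i, K (Some i) -> forall n, (x i n <= y n)%N.
Proof.
move=> cK; apply: contrapT => /forallNP nb.
have [n nP] : exists n, forall m, exists i, K (Some i) /\ (m < x i n)%N.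
  apply: contrapT => /forallNP nn.
  have /choice[y yP] : forall n, exists m, forall i, K (Some i) -> (x i n <= m)%N.
    move=> n; have /existsNP[m mP] := nn n; exists m => i Ki; rewrite leqNgt.
    by apply/negP => mi; apply: mP; exists i.
  by apply: (nb y) => i Ki k; apply: yP.
have /choice[c cP] := nP.
pose W j := ~` [set Some (c k) | k in [set k | (j <= k)%N]] : set (fan x).
have [|||j jP] := @compact_increasing_cover (fan x) K W cK.
- move=> j; rewrite fan_openE => _ y; exists n.+1.
  apply: (@sub_finite_set _ _ (c @` `I_(y n))); last exact/finite_image/finite_II.
  move=> i [yi /= /contrapT[k /= _ [cki]]]; exists k => //=.
  by have := yi n (ltnSn n); rewrite -cki; apply: leq_trans; apply: (cP k).2.
- by move=> j k jk p Wp [l /= kl lp]; apply: Wp; exists l => //=; apply: leq_trans kl.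
- move=> [i|] _; last by exists 0 => // -[].
  exists (x i n) => // -[k /= ik [cki]].
  by have := (cP k).2; rewrite cki ltnNge ik.
by apply: (jP (Some (c j)) (cP j).1); exists j => /=.
Qed.

Lemma fan_compact_countable (K : set (fan x)) :
  (forall S y, ~ countable S -> exists2 i, S i & ~ forall n, (x i n <= y n)%N) ->
  compact K -> countable K.
Proof.
move=> ub /fan_compact_bounded[y yP].
have cS : countable [set i | K (Some i)].
  by apply: contrapT => ucS; have [i Ki] := ub _ y ucS; apply; apply: yP.
apply: (@countableS _ _ (\bigcup_n bigcup2 (Some @` [set i | K (Some i)]) [set None] n)).
  by move=> [i|] Kp; rewrite bigcup2E; [left; exists i|right].
by apply: bigcup_countable => // -[|[|n]] _ //=; apply: countable_image.
Qed.

(** The bits [inl (n, k)] of a point of the cube form a relation between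
    coordinates and their bounds, and the bits [inr i] a subset of [I]. *)
Definition cube := prod_topology (fun _ : nat * nat + I => bool).

HB.instance Definition _ := Uniform.on cube.

Definition bit (t : nat * nat + I) : set cube := [set p | p t].

Lemma cube_clopen t : clopen (bit t).
Proof.
have ct : continuous (fun p : cube => p t) := @proj_continuous _ (fun=> bool) t.
split; [move/continuousP: ct|move/continuous_closedP: ct].
  by move=> /(_ [set true]); apply; apply: discrete_open.
by move=> /(_ [set true]); apply; apply: discrete_closed.
Qed.

(** The subset of [I] has at most one element [i], the empty subset coding
    [None], and every bound present in the relation is a bound for [x i]. *)
Definition fan_codes : set cube :=
  [set p | (forall i j, p (inr i) -> p (inr j) -> i = j) /\
    forall i n k, p (inr i) -> p (inl (n, k)) -> (x i n <= k)%N].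

Lemma fan_codes_closed : closed fan_codes.
Proof.
have -> : fan_codes =
    (\bigcap_(ij in [set ij : I * I | ij.1 <> ij.2])
       (~` bit (inr ij.1) `|` ~` bit (inr ij.2))) `&`
    \bigcap_(t in [set t : I * (nat * nat) | ~ (x t.1 t.2.1 <= t.2.2)%N])
       (~` bit (inr t.1) `|` ~` bit (inl t.2)).
  apply/seteqP; split=> p [p1 p2]; split.
  - by move=> [i j] /= ij; apply/not_andP => -[pi /(p1 _ _ pi)].
  - by move=> [i [n k]] /= ink; apply/not_andP => -[pi /(p2 _ _ _ pi)].
  - by move=> i j pi pj; apply: contrapT => ij; have [] := p1 (i, j) ij; apply.
  - move=> i n k pi pk; apply: contrapT => ink.
    by have [] := p2 (i, (n, k)) ink; apply.
by apply: closedI; apply: closed_bigI => t _; apply: closedU;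
  apply: open_closedC; apply: (cube_clopen _).1.
Qed.

(** The codes in which each coordinate has some bound form a Lindeloef
    Cech-complete subspace of the cube, which maps continuously onto the fan.
    Continuity at a code of [None]: choose a bound [y n] for each coordinate
    [n]; a neighbourhood of [None] omits only finitely many [i] below [y] on an
    initial segment, and finitely many bits of a code preserve these bounds and
    exclude these [i]. *)
Lemma fan_K_analytic (R : realType) : K_analytic (fan x).
Proof.
have cC : compact [set: cube].
  have := @tychonoff _ (fun _ : nat * nat + I => bool) (fun=> setT) (fun=> bool_compact).
  by congr compact; apply/seteqP; split.
have hC : hausdorff_space cube by apply: hausdorff_product => t; apply: discrete_hausdorff.
pose F n k := bit (inl (n, k)).
have cF n k : closed (F n k) by apply: (cube_clopen _).2.
have oF n : open (\bigcup_k F n k) by apply: bigcup_open => k _; apply: (cube_clopen _).1.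
pose Z := fan_codes `&` \bigcap_n \bigcup_k F n k.
exists Z; split.
- exact: ksigmadelta_lindelof fan_codes_closed cF.
- exact: (ksigmadelta_cech_complete cC hC fan_codes_closed oF R).
have /choice[f fP] : forall z : Z, exists q : fan x,
    if q is Some i then val z (inr i) else forall i, ~ val z (inr i).
  move=> z; have [[i zi]|/forallNP zi] := pselect (exists i, val z (inr i)).
    by exists (Some i).
  by exists None.
have near_bit (z : Z) t : val z t -> \forall z' \near z, val (z' : Z) t.
  move=> zt; apply: open_nbhs_nbhs; split=> //.
  by exists (bit t) => //; apply: (cube_clopen t).1.
have near_nbit (z : Z) t : ~ val z t -> \forall z' \near z, ~ val (z' : Z) t.
  move=> zt; apply: open_nbhs_nbhs; split=> //.
  by exists (~` bit t) => //; apply: closed_openC; apply: (cube_clopen t).2.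
have fSome (z : Z) i : val z (inr i) -> f z = Some i.
  move=> zi; have [[zuniq _] _] := set_mem (valP z).
  by have := fP z; case: (f z) => [j zj|/(_ i)//]; rewrite (zuniq _ _ zi zj).
exists f.
  move=> z V nV; case fz : (f z) => [i|].
    have := nbhs_singleton nV; have := fP z; rewrite fz => /near_bit + Vi.
    by apply: filterS => z' /fSome z'i; rewrite /= z'i.
  move: nV; rewrite fz nbhsE => -[U [oU U0] UV]; have zN := fP z; rewrite fz in zN.
  have [_ zF] := set_mem (valP z).
  have /choice[y yP] : forall n, exists k, val z (inl (n, k)).
    by move=> n; have [k _ zk] := zF n Logic.I; exists k.
  have [n /finite_seqP[s sE]] := oU U0 y.
  have near_y : forall m, \forall z' \near z, forall k, (k < m)%N -> val (z' : Z) (inl (k, y k)).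
    elim=> [|m IH]; first by apply: filterS filterT => z' _ k.
    near=> z' => k; rewrite ltnS leq_eqVlt => /predU1P[->|km].
      by near: z'; apply: near_bit.
    by move: k km; near: z'.
  have near_s : forall l : seq I, \forall z' \near z, forall i, i \in l -> ~ val (z' : Z) (inr i).
    elim=> [|j l IH]; first by apply: filterS filterT => z' _ k.
    near=> z' => k; rewrite inE => /predU1P[->|km].
      by near: z'; apply: near_nbit.
    by move: k km; near: z'.
  suff : \forall z' \near z, V (f z') by [].
  near=> z'.
  have z's : forall i, i \in s -> ~ val z' (inr i) by near: z'; apply: near_s.
  have z'y : forall k, (k < n)%N -> val z' (inl (k, y k)) by near: z'; apply: near_y.
  apply: UV; have := fP z'.
  case: (f z') => [i z'i|//]; apply: contrapT => nUi.
  apply: (z's i) => //.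
  suff : (below n y `&` [set i | ~ U (Some i)]) i by rewrite sE.
  split=> // k kn; have [[_ z'b] _] := set_mem (valP z').
  by apply: z'b z'i _; apply: z'y.
apply/seteqP; split=> // -[i|] _.
  pose p : cube := fun t => match t with inl nk => x i nk.1 == nk.2 | inr j => i == j end.
  have Zp : Z p.
    split; last by move=> n _; exists (x i n) => //; rewrite /F /bit /= eqxx.
    split=> [j k /eqP <- /eqP <- //|j n k /eqP <- /eqP /= <-]; exact: leqnn.
  by exists (SigSub (mem_set Zp)) => //; apply: fSome; rewrite /= eqxx.
pose p : cube := fun t => if t is inl nk then true else false.
have Zp : Z p by split=> // n _; exists 0.
exists (SigSub (mem_set Zp)) => //.
by have := fP (SigSub (mem_set Zp)); case: (f _).
Unshelve. all: by end_near. Qed.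

End Fan.

(** * The equivalence *)

Lemma fan_omega1_lt_b (R : realType) :
  (forall X : topologicalType, K_analytic X -> hausdorff_space X ->
     unique_non_isolated_point X ->
     (forall K : set X, compact K -> countable K) -> countable [set: X]) ->
  omega1_lt_b.
Proof.
move=> countX; apply: contrapT => /not_omega1_lt_b_unbounded[I [x [ucI ub]]].
apply: (ucI).
have cfan : countable [set: fan x].
  apply: countX.
  - exact: fan_K_analytic.
  - exact: fan_hausdorff.
  - exact: fan_unique_non_isolated.
  - by move=> K; apply: fan_compact_countable.
by apply: (countable_inj_on (f := Some : I -> fan x)) cfan => // i j _ _ [].
Qed.

Theorem theorem4 (R : realType) :
  [<-> omega1_lt_b;
       forall X : topologicalType, K_analytic X -> hausdorff_space X ->
         (analytic R X <->
          forall K : set X, compact K -> metrizable R (set_type K));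
       forall X : topologicalType, K_analytic X ->
         (countable [set: X] <->
          forall K : set X, compact K -> countable K);
       forall X : topologicalType, K_analytic X -> hausdorff_space X ->
         unique_non_isolated_point X ->
         (countable [set: X] <->
          forall K : set X, compact K -> countable K)].
Proof.
have lt_b_3 : omega1_lt_b -> forall X : topologicalType, K_analytic X ->
    (countable [set: X] <-> forall K : set X, compact K -> countable K).
  move=> lt_b X /K_analytic_usco_resolution[Phi uPhi]; split=> [cX K _|cK].
    exact: countableS cX.
  apply: (omega1_lt_b_countable lt_b uPhi) => y; apply: cK.
  by have [cPhi _ _ _] := uPhi.
tfae.
- move=> lt_b X /K_analytic_usco_resolution[Phi uPhi] hX; split=> [aX K cK|mK].
    apply: compact_subset_metrizable => //.
    exact: network_subset (@subsetT _ K) (analytic_network aX).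
  apply: (omega1_lt_b_analytic R lt_b hX uPhi) => y.
  have [/(_ y) cPhi _ _ _] := uPhi.
  exact: compact_metrizable_network cPhi (mK _ cPhi).
- (* Countable compact sets are metrizable, so the hypothesis makes the spaces
     with one non-isolated point and countable compact sets analytic. *)
  move=> P2; apply: lt_b_3; apply: (fan_omega1_lt_b R) => X kX hX uX cK.
  apply: network_isolated_complement_countable uX.
  apply: (analytic_network (R := R)); apply/P2 => // K compK.
  apply: compact_subset_metrizable => //.
  exact/network_countable/cK.
- by move=> P3 X kX _ _; apply: P3.
- by move=> P4; apply: (fan_omega1_lt_b R) => X kX hX uX /(P4 X kX hX uX).
Qed.
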